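(* Let $X$ be a topological space. If $X$ is $Ps$-Tychonoff, then $X$ is $C$-Tychonoff.
   Context: A topological space is pseudocompact if every real-valued continuous function on it is bounded; a subset is called pseudocompact if it is pseudocompact in the subspace topology. No separation axiom is assumed in compactness or pseudocompactness. Tychonoff means completely regular and $T_1$. A space $X$ is $Ps$-Tychonoff (resp. $C$-Tychonoff) if there exist a Tychonoff space $Y$ and a bijection $f:X\to Y$ such that $f|_K:K\to f(K)$ is a homeomorphism (subspace topologies) for every pseudocompact (resp. compact) subset $K$ of $X$. *)

(* Defs.v *)
From HB Require Import structures.
From mathcomp Require Import all_boot all_order all_algebra.
From mathcomp Require Import all_classical all_reals all_analysis.

Set Implicit Arguments.
Unset Strict Implicit.
Unset Printing Implicit Defensive.

Import Order.TTheory GRing.Theory Num.Theory.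
Import numFieldNormedType.Exports.

Local Open Scope classical_set_scope.
Local Open Scope ring_scope.

Definition pseudocompact_space (R : realType) (T : topologicalType) : Prop :=
  forall f : T -> R, continuous f -> [bounded f x | x in [set: T]].

(* The coercion of [K] to the type [set_type K] carries the subspace topology
   (initial topology of the inclusion). *)
Definition pseudocompact (R : realType) (X : topologicalType) (K : set X) :
    Prop :=
  pseudocompact_space R K.

(* [uniform_separatorP] identifies [completely_regular_space] with the
   separation of points from closed sets by continuous functions into [0, 1]. *)
Definition tychonoff_space (T : topologicalType) : Prop :=
  completely_regular_space T /\ accessible_space T.

Definition homeomorphism (S T : topologicalType) (f : S -> T) : Prop :=
  exists g : T -> S,
    [/\ cancel f g, cancel g f, continuous f & continuous g].

(* [sigLR [fun f in K]] is the map from the subtype [K] to the subtype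
   [f @` K] induced by [f]. *)
Definition restriction_homeomorphism (X Y : topologicalType) (f : X -> Y)
    (K : set X) : Prop :=
  @homeomorphism K (f @` K) (sigLR [fun f in K]).

Definition Ps_tychonoff (R : realType) (X : topologicalType) : Prop :=
  exists (Y : topologicalType) (f : X -> Y),
    [/\ tychonoff_space Y, bijective f &
        forall K : set X, pseudocompact R K -> restriction_homeomorphism f K].

Definition C_tychonoff (X : topologicalType) : Prop :=
  exists (Y : topologicalType) (f : X -> Y),
    [/\ tychonoff_space Y, bijective f &
        forall K : set X, compact K -> restriction_homeomorphism f K].

(* Main.v *)
Require Import Defs.
From mathcomp Require Import all_boot all_order all_algebra.
From mathcomp Require Import all_classical all_reals all_analysis.

Import numFieldNormedType.Exports.

Local Open Scope classical_set_scope.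

(** A continuous real-valued function on a compact space has compact, hence bounded, image, so
    compact subsets are pseudocompact. The same [Y] and [f] therefore serve for both properties. As
    [pseudocompact] speaks of the subtype [K], compactness must first pass from [X] to that
    subtype. *)

Lemma compact_set_type (X : topologicalType) (K : set X) :
  compact K -> compact [set: K].
Proof.
move=> cptK F FF _.
(* Pushing [F] forward along the inclusion gives a filter on [X] containing [K], to which [cptK]
   applies. *)
have FK : (set_val @ F) K by apply: (filterE (F := F)) => x; exact: set_valP.
have [x [Kx clx]] := cptK (set_val @ F) _ FK.
exists (exist _ x (mem_set Kx)); split => // A B FA.
(* Each neighbourhood in the subtype contains the trace of an open [W] of [X], so clustering in [X]
   descends to the subtype. *)
rewrite nbhsE => -[U [[W oW <-] Wx] UB].
have Fimg : (set_val @ F) (set_val @` A).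
  exact: (filterS (F := F) (@preimage_image _ _ set_val A) FA).
have [_ [[y Ay <-] Wy]] := clx _ W Fimg (open_nbhs_nbhs (conj oW Wx)).
by exists y; split => //; exact: UB.
Qed.

Lemma compact_pseudocompact (R : realType) (X : topologicalType) (K : set X) :
  compact K -> pseudocompact R K.
Proof.
move=> /compact_set_type cptK f cf.
have /compact_bounded[M [Mreal bM]] : compact (f @` [set: K]).
  by apply: continuous_compact cptK; exact: continuous_subspaceT.
by exists M; split => // N MN x _; apply: (bM N MN); exists x.
Qed.

Theorem theorem3p2 (R : realType) (X : topologicalType) :
  Ps_tychonoff R X -> C_tychonoff X.
Proof.
move=> [Y [f [tychY bijf homeo]]]; exists Y, f; split => // K cptK.
by apply: homeo; exact: compact_pseudocompact.
Qed.
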